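(* Let $\Lambda$ be a noetherian ring and let $T$ be a cotilting $\Lambda$-module. Let $\mathcal{X}_T$ be the subcategory of $\mathrm{mod}\,\Lambda$ consisting of the modules $X$ with $\mathrm{Ext}^i_\Lambda(X,T)=0$ for all $i>0$. Then $$\mathcal{X}_T\text{-}\mathrm{tri.dim}\,\mathsf{D}^{\mathrm{b}}(\mathrm{mod}\,\Lambda)\le\max\{1,\mathrm{inj.dim}\,T\}.$$
   Context: Rings are associative, noetherian, with identity. $\mathrm{mod}\,\Lambda$ is the category of finitely generated right $\Lambda$-modules. All subcategories are full and closed under isomorphisms. $\mathsf{D}^{\mathrm{b}}(\mathrm{mod}\,\Lambda)$ is the bounded derived category, with modules regarded as complexes in degree $0$. A finitely generated $\Lambda$-module $T$ is cotilting if: (1) the injective dimension $\mathrm{inj.dim}\,T$ of the $\Lambda$-module $T$ is finite; (2) $\mathrm{Ext}^i_\Lambda(T,T)=0$ for all $i>0$; (3) for any $X\in\mathcal{X}_T$ there is an exact sequence $0\to X\to T'\to X'\to0$ in $\mathrm{mod}\,\Lambda$ with $T'\in\mathrm{add}\,T$ and $X'\in\mathcal{X}_T$. Relative dimension: for subcategories $\mathcal{X},\mathcal{Y}$ of a triangulated category $\mathcal{T}$, $\mathcal{X}*\mathcal{Y}$ is the subcategory of objects $M$ admitting an exact triangle $X\to M\to Y\to X[1]$ with $X\in\mathcal{X}$, $Y\in\mathcal{Y}$ (this operation is associative). $\mathrm{add}\,\mathcal{X}$ is the smallest subcategory containing $\mathcal{X}$ closed under finite direct sums and direct summands. Put $\langle\mathcal{X}\rangle=\mathrm{add}\{X[i]\mid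 X\in\mathcal{X},\,i\in\mathbb{Z}\}$ and, for $n\ge 1$, $\langle\mathcal{X}\rangle_n=\mathrm{add}(\langle\mathcal{X}\rangle*\cdots*\langle\mathcal{X}\rangle)$ ($n$ factors). Then $\mathcal{X}\text{-}\mathrm{tri.dim}\,\mathcal{T}:=\inf\{n\ge0\mid\mathcal{T}=\langle\mathcal{X}\rangle_{n+1}\}$ (with value $\infty$ if there is no such $n$). *)

(* Defs.v *)
From HB Require Import structures.
From mathcomp Require Import all_boot all_order all_algebra.
From mathcomp Require Import boolp constructive_ereal.

Set Implicit Arguments.
Unset Strict Implicit.
Unset Printing Implicit Defensive.

Import Order.TTheory GRing.Theory Num.Theory.
Local Open Scope ring_scope.

(* Modules are MathComp's left modules over a ring R; right modules over L are
   obtained by taking R := L^c, the converse ring. *)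

(* inf {n | P n} in N + {oo}, as an extended integer; +oo if P is empty *)
Definition einfn (P : nat -> Prop) : \bar int :=
  if pselect (exists n, `[< P n >]) is left exP
  then (Posz (ex_minn exP))%:E else +oo%E.

(* add P: the closure of P under isomorphism, finite direct sums (including
   the empty one) and direct summands. *)
Inductive add (Ob : Type) (iso : Ob -> Ob -> Prop) (zero : Ob)
    (sum : Ob -> Ob -> Ob) (P : Ob -> Prop) : Ob -> Prop :=
| add_in X : P X -> add iso zero sum P X
| add_iso X Y : iso X Y -> add iso zero sum P X -> add iso zero sum P Y
| add_zero : add iso zero sum P zero
| add_sum X Y : add iso zero sum P X -> add iso zero sum P Y ->
    add iso zero sum P (sum X Y)
| add_summand X Y : add iso zero sum P (sum X Y) -> add iso zero sum P X.

Definition left_ideal (R : pzRingType) (I : R -> Prop) : Prop :=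
  [/\ I 0, (forall x y, I x -> I y -> I (x + y))
    & (forall a x, I x -> I (a * x))].

Definition left_noetherian (R : pzRingType) : Prop :=
  forall I : R -> Prop, left_ideal I ->
  exists n (e : 'I_n -> R), (forall i, I (e i)) /\
    forall x, I x -> exists a : 'I_n -> R, x = \sum_i a i * e i.

(* Two-sided: multiplication in R^c is reversed, so left ideals of R^c are
   right ideals of R. *)
Definition noetherian (R : pzRingType) : Prop :=
  left_noetherian R /\ left_noetherian R^c.

Section Modules.
Variable R : pzRingType.
Implicit Types M N : lmodType R.

Definition finitely_generated M : Prop :=
  exists n (e : 'I_n -> M),
    forall x, exists a : 'I_n -> R, x = \sum_i a i *: e i.

Record fgmod := FgMod {
  fgmod_sort :> lmodType R;
  fgmodP : finitely_generated fgmod_sort }.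

Definition mod_iso (M N : fgmod) : Prop :=
  exists f : {linear M -> N}, bijective f.

Lemma fg_zero : finitely_generated 'rV[R]_0.
Proof.
exists 0%N, (fun _ => 0) => x; exists (fun _ => 0).
by rewrite big_ord0; apply/rowP => -[].
Qed.

Definition fg0 : fgmod := FgMod fg_zero.

Lemma fg_prod (M N : fgmod) : finitely_generated (M * N)%type.
Proof.
case: M N => [M [m [e He]]] [N [n [f Hf]]] /=.
exists (m + n)%N, (fun k => match split k with
  inl i => (e i, 0) | inr j => (0, f j) end) => -[x y].
have [a ->] := He x; have [b ->] := Hf y.
exists (fun k => match split k with inl i => a i | inr j => b j end).
rewrite big_split_ord /=.
have El (i : 'I_m) : split (lshift n i) = inl i by exact: (unsplitK (inl i)).
have Er (j : 'I_n) : split (rshift m j) = inr j by exact: (unsplitK (inr j)).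
under [X in _ = X + _]eq_bigr do rewrite El.
under [X in _ = _ + X]eq_bigr do rewrite Er.
apply: injective_projections; rewrite /= !raddf_sum /=.
- by rewrite [X in _ + X]big1 ?addr0 // => i _; rewrite scaler0.
- by rewrite [X in X + _]big1 ?add0r // => i _; rewrite scaler0.
Qed.

Definition fg_sum (M N : fgmod) : fgmod := FgMod (fg_prod M N).

Definition projective (P : lmodType R) : Prop :=
  forall (M N : lmodType R) (p : {linear M -> N}) (f : {linear P -> N}),
    (forall y, exists x, p x = y) ->
    exists g : {linear P -> M}, forall x, p (g x) = f x.

Definition injective_module (I : lmodType R) : Prop :=
  forall (M N : lmodType R) (i : {linear M -> N}) (f : {linear M -> I}),
    injective i -> exists g : {linear N -> I}, forall x, g (i x) = f x.

Definition projective_resolution M (P : nat -> lmodType R)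
    (d : forall n, {linear P n.+1 -> P n}) (eps : {linear P 0%N -> M}) : Prop :=
  [/\ forall n, projective (P n),
      forall y, exists x, eps x = y,
      forall x, eps x = 0 <-> exists y, d 0%N y = x
    & forall n x, d n x = 0 <-> exists y, d n.+1 y = x].

(* Ext^i(M, N) = 0: the i-th cohomology of Hom(P, N) vanishes, for any
   projective resolution P of M (one exists, and they all agree on this). *)
Definition Ext_eq0 (i : nat) M N : Prop :=
  forall (P : nat -> lmodType R) (d : forall n, {linear P n.+1 -> P n})
    (eps : {linear P 0%N -> M}), projective_resolution d eps ->
  match i with
  | 0 => forall g : {linear P 0%N -> N},
           (forall x, g (d 0%N x) = 0) -> forall x, g x = 0
  | n.+1 => forall g : {linear P n.+1 -> N},
           (forall x, g (d n.+1 x) = 0) ->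
           exists h : {linear P n -> N}, forall x, g x = h (d n x)
  end.

(* 0 -> M -> I 0 -> ... -> I n -> 0 exact with injective terms *)
Definition injdim_le M (n : nat) : Prop :=
  exists (I : nat -> lmodType R) (eta : {linear M -> I 0%N})
         (d : forall k, {linear I k -> I k.+1}),
  [/\ forall k, injective_module (I k),
      forall k, (n < k)%N -> forall x : I k, x = 0,
      injective eta,
      forall x, d 0%N x = 0 <-> exists y, eta y = x
    & forall k x, d k.+1 x = 0 <-> exists y, d k y = x].

Definition inj_dim M : \bar int := einfn (injdim_le M).

Definition XT (T : fgmod) (X : fgmod) : Prop :=
  forall i, (0 < i)%N -> Ext_eq0 i X T.

Definition short_exact (A B C : fgmod)
    (f : {linear A -> B}) (g : {linear B -> C}) : Prop :=
  [/\ injective f, forall y, exists x, g x = y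
    & forall x, g x = 0 <-> exists y, f y = x].

Definition cotilting (T : fgmod) : Prop :=
  [/\ (inj_dim T < +oo)%E,
      forall i, (0 < i)%N -> Ext_eq0 i T T
    & forall X : fgmod, XT T X ->
      exists (T' X' : fgmod) (f : {linear X -> T'}) (g : {linear T' -> X'}),
        [/\ short_exact f g,
            add mod_iso fg0 fg_sum (mod_iso T) T' & XT T X']].

End Modules.

Section Complexes.
Variable R : pzRingType.

(* Bounded cochain complexes of finitely generated modules.  The differential
   is given between any two degrees, and is zero unless the second is the
   successor of the first; this makes shifts cast-free. *)
Record cpx := Cpx {
  term :> int -> fgmod R;
  diff : forall i j, {linear term i -> term j};
  diff_shape : forall i j x, j != i + 1 -> diff i j x = 0;
  diff_diff : forall i j k x, diff j k (diff i j x) = 0;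
  cpx_bounded : exists N : nat,
    forall i, (N < `|i|)%N -> forall x : term i, x = 0 }.

Record cmap (A B : cpx) := CMap {
  cmap_at :> forall i, {linear A i -> B i};
  cmap_diff : forall i j x,
    diff B i j (cmap_at i x) = cmap_at j (diff A i j x) }.

Lemma id_cmap_diff (A : cpx) i j (x : A i) :
  diff A i j (idfun x) = idfun (diff A i j x).
Proof. by []. Qed.

Definition id_cmap (A : cpx) : cmap A A :=
  @CMap A A (fun i => idfun) (@id_cmap_diff A).

Lemma comp_cmap_diff (A B C : cpx) (g : cmap B C) (f : cmap A B) i j x :
  diff C i j ((g i \o f i) x) = (g j \o f j) (diff A i j x).
Proof. by rewrite /= !cmap_diff. Qed.

Definition comp_cmap (A B C : cpx) (g : cmap B C) (f : cmap A B) : cmap A C :=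
  @CMap A C (fun i => g i \o f i) (comp_cmap_diff g f).

(* Only k = i + 1, resp. j = i - 1, is a genuine condition. *)
Definition cocycle (A : cpx) i (z : A i) : Prop :=
  forall k, diff A i k z = 0.
Definition coboundary (A : cpx) i (z : A i) : Prop :=
  exists j (x : A j), diff A j i x = z.

(* Every H^i(f) is injective and surjective *)
Definition quasi_iso (A B : cpx) (f : cmap A B) : Prop :=
  forall i,
    (forall z : A i, cocycle z -> coboundary (f i z) -> coboundary z) /\
    (forall w : B i, cocycle w ->
      exists2 z : A i, cocycle z & coboundary (w - f i z)).

Section Stalk.
Variable M : fgmod R.

Definition stalk_term (i : int) : fgmod R := if i == 0 then M else fg0 R.
Definition stalk_diff i j : {linear stalk_term i -> stalk_term j} := \0.

Lemma stalk_shape i j (x : stalk_term i) :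
  j != i + 1 -> stalk_diff i j x = 0.
Proof. by []. Qed.

Lemma stalk_dd i j k (x : stalk_term i) :
  stalk_diff j k (stalk_diff i j x) = 0.
Proof. by []. Qed.

Lemma stalk_bounded : exists N : nat,
  forall i, (N < `|i|)%N -> forall x : stalk_term i, x = 0.
Proof.
exists 0%N => i; rewrite absz_gt0 /stalk_term => /negPf -> x.
by apply/rowP => -[].
Qed.

Definition stalk : cpx := Cpx stalk_shape stalk_dd stalk_bounded.

End Stalk.

Definition cpx0 : cpx := stalk (fg0 R).

Section Sum.
Variables A B : cpx.

Definition sum_diff_fun i j (p : fg_sum (A i) (B i)) : fg_sum (A j) (B j) :=
  (diff A i j p.1, diff B i j p.2).

Lemma sum_diff_linear i j : linear (@sum_diff_fun i j).
Proof. by move=> a p q; rewrite /sum_diff_fun !linearP. Qed.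

HB.instance Definition _ i j :=
  GRing.isLinear.Build R _ _ _ (@sum_diff_fun i j) (@sum_diff_linear i j).

Definition sum_diff i j :
  {linear fg_sum (A i) (B i) -> fg_sum (A j) (B j)} := @sum_diff_fun i j.

Lemma sum_shape i j x : j != i + 1 -> sum_diff i j x = 0.
Proof. by move=> h; rewrite /= /sum_diff_fun !diff_shape. Qed.

Lemma sum_dd i j k x : sum_diff j k (sum_diff i j x) = 0.
Proof. by rewrite /= /sum_diff_fun /= !diff_diff. Qed.

Lemma sum_bounded : exists N : nat,
  forall i, (N < `|i|)%N -> forall x : fg_sum (A i) (B i), x = 0.
Proof.
have [m Am] := cpx_bounded A; have [n Bn] := cpx_bounded B.
exists (maxn m n) => i; rewrite gtn_max => /andP[hm hn] [x y].
by rewrite (Am i hm x) (Bn i hn y).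
Qed.

Definition cpx_sum : cpx := Cpx sum_shape sum_dd sum_bounded.

End Sum.

Section Shift.
Variables (A : cpx) (n : int).

Definition shift_term (i : int) : fgmod R := A (i + n).

(* (-1) ^ n times the differential of A *)
Definition shift_diff i j : {linear shift_term i -> shift_term j} :=
  if odd `|n| then \- diff A (i + n) (j + n) : {linear _ -> _}
  else diff A (i + n) (j + n).

Lemma shift_shape i j x : j != i + 1 -> shift_diff i j x = 0.
Proof.
move=> h; have h' : j + n != i + n + 1 by rewrite addrAC (inj_eq (addIr _)).
by rewrite /shift_diff; case: ifP => _ /=; rewrite diff_shape ?oppr0.
Qed.

Lemma shift_dd i j k x : shift_diff j k (shift_diff i j x) = 0.
Proof.
rewrite /shift_diff; case: ifP => _ /=; last exact: diff_diff.
by rewrite linearN opprK diff_diff.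
Qed.

Lemma shift_bounded : exists N : nat,
  forall i, (N < `|i|)%N -> forall x : shift_term i, x = 0.
Proof.
have [N AN] := cpx_bounded A; exists (N + `|n|)%N => i hi; apply: AN.
have : (`|i| <= `|(i + n)%R| + `|n|)%N.
  by rewrite -lez_nat PoszD !abszE -{1}(addrK n i) ler_normB.
by move=> h; rewrite -(ltn_add2r `|n|) (leq_trans hi).
Qed.

Definition shift : cpx := Cpx shift_shape shift_dd shift_bounded.

End Shift.

Section ShiftMap.
Variables (A B : cpx) (f : cmap A B) (n : int).

Definition shift_cmap_at i : {linear shift A n i -> shift B n i} := f (i + n).

Lemma shift_cmap_diff i j x : diff (shift B n) i j (shift_cmap_at i x) =
  shift_cmap_at j (diff (shift A n) i j x).
Proof.
rewrite /shift_cmap_at /= /shift_diff; case: ifP => _ /=; rewrite cmap_diff //.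
by rewrite linearN.
Qed.

Definition shift_cmap : cmap (shift A n) (shift B n) := CMap shift_cmap_diff.

End ShiftMap.

Lemma shift_cocycle (A : cpx) n i (z : A (i + n)) :
  cocycle (A := shift A n) (i := i) z <-> cocycle z.
Proof.
split=> h k; last first.
  by rewrite /= /shift_diff; case: ifP => _ /=; rewrite h ?oppr0.
have := h (k - n); rewrite /= /shift_diff /shift_term subrK.
by case: ifP => _ //= /eqP; rewrite oppr_eq0 => /eqP.
Qed.

Lemma shift_coboundary (A : cpx) n i (z : A (i + n)) :
  coboundary (A := shift A n) (i := i) z <-> coboundary z.
Proof.
split=> -[j].
  rewrite /= /shift_diff; case: ifP => _ /= [x <-]; exists (j + n).
    by exists (- x); rewrite linearN.
  by exists x.
rewrite -(subrK n j) => -[x <-]; exists (j - n).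
rewrite /= /shift_diff; case: ifP => _ /=; last by exists x.
by exists (- x); rewrite linearN opprK.
Qed.

Lemma shift_quasi_iso (A B : cpx) (f : cmap A B) n :
  quasi_iso f -> quasi_iso (shift_cmap f n).
Proof.
move=> qf i; have [inj_f surj_f] := qf (i + n); split=> [z|w].
  move=> /shift_cocycle cz /shift_coboundary bz.
  by apply/shift_coboundary; apply: inj_f.
move=> /shift_cocycle cw; have [z cz bz] := surj_f w cw.
by exists z; [apply/shift_cocycle | apply/shift_coboundary].
Qed.

Section Cone.
Variables (A B : cpx) (f : cmap A B).

Definition cone_term (i : int) : fgmod R := fg_sum (A (i + 1)) (B i).

(* f, seen as a map A (i + 1) -> B j; zero if j <> i + 1 *)
Definition cone_conn i j : {linear A (i + 1) -> B j} :=
  if i + 1 =P j is ReflectT e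
  then ecast k {linear A (i + 1) -> B k} e (f (i + 1)) else \0.

Definition cone_diff_fun i j (p : cone_term i) : cone_term j :=
  (- diff A (i + 1) (j + 1) p.1, cone_conn i j p.1 + diff B i j p.2).

Lemma cone_diff_linear i j : linear (@cone_diff_fun i j).
Proof.
move=> a p q; apply: injective_projections; rewrite /= !linearP //.
by rewrite scalerDr addrACA.
Qed.

HB.instance Definition _ i j :=
  GRing.isLinear.Build R _ _ _ (@cone_diff_fun i j) (@cone_diff_linear i j).

Definition cone_diff i j : {linear cone_term i -> cone_term j} :=
  @cone_diff_fun i j.

Lemma cone_shape i j x : j != i + 1 -> cone_diff i j x = 0.
Proof.
move=> h; have h' : j + 1 != i + 1 + 1 by rewrite (inj_eq (addIr _)).
rewrite /= /cone_diff_fun !diff_shape // oppr0 addr0 /cone_conn.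
by case: eqP => // e; rewrite e eqxx in h.
Qed.

Lemma cone_dd i j k x : cone_diff j k (cone_diff i j x) = 0.
Proof.
rewrite /= /cone_diff_fun /= linearN diff_diff opprK; congr pair.
rewrite linearD /= diff_diff addr0 linearN /cone_conn addrC.
case: eqP => [e|ne]; last first.
  rewrite linear0 add0r diff_shape ?linear0 ?oppr0 //.
  by rewrite (inj_eq (addIr _)); apply/eqP => e; apply: ne.
case: eqP => [e'|ne]; last first.
  by rewrite subr0 diff_shape //; apply/eqP => e'; apply: ne.
by subst j k; rewrite /= cmap_diff subrr.
Qed.

Lemma cone_bounded : exists N : nat,
  forall i, (N < `|i|)%N -> forall x : cone_term i, x = 0.
Proof.
have [m Am] := shift_bounded A 1; have [n Bn] := cpx_bounded B.
exists (maxn m n) => i; rewrite gtn_max => /andP[hm hn] [x y].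
by rewrite (Am i hm x) (Bn i hn y).
Qed.

Definition cone : cpx := Cpx cone_shape cone_dd cone_bounded.

Definition cone_in_fun i (y : B i) : cone i := (0, y).

Lemma cone_in_linear i : linear (@cone_in_fun i).
Proof.
move=> a x y; apply: injective_projections => //=.
by rewrite scaler0 addr0.
Qed.

HB.instance Definition _ i :=
  GRing.isLinear.Build R _ _ _ (@cone_in_fun i) (@cone_in_linear i).

Definition cone_in_at i : {linear B i -> cone i} := @cone_in_fun i.

Lemma cone_in_diff i j y :
  diff cone i j (cone_in_at i y) = cone_in_at j (diff B i j y).
Proof.
by rewrite /= /cone_diff_fun /cone_in_fun /= !linear0 add0r.
Qed.

Definition cone_in : cmap B cone := CMap cone_in_diff.

Definition cone_out_fun i (p : cone i) : shift A 1 i := p.1.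

Lemma cone_out_linear i : linear (@cone_out_fun i).
Proof. by []. Qed.

HB.instance Definition _ i :=
  GRing.isLinear.Build R _ _ _ (@cone_out_fun i) (@cone_out_linear i).

Definition cone_out_at i : {linear cone i -> shift A 1 i} := @cone_out_fun i.

Lemma cone_out_diff i j p :
  diff (shift A 1) i j (cone_out_at i p) = cone_out_at j (diff cone i j p).
Proof. by []. Qed.

Definition cone_out : cmap cone (shift A 1) := CMap cone_out_diff.

End Cone.

(* The bounded derived category: the localization of the category of bounded
   complexes at the quasi-isomorphisms.  Morphisms are formal composites of
   chain maps and of inverses of quasi-isomorphisms, modulo db_eq, the
   congruence generated by the relations of a localization. *)
Inductive db_hom : cpx -> cpx -> Type :=
| db_map A B (f : cmap A B) : db_hom A B
| db_inv A B (s : cmap A B) : quasi_iso s -> db_hom B A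
| db_comp A B C : db_hom B C -> db_hom A B -> db_hom A C.

Definition db_id (A : cpx) : db_hom A A := db_map (id_cmap A).

Inductive db_eq : forall A B, db_hom A B -> db_hom A B -> Prop :=
| db_refl A B (u : db_hom A B) : db_eq u u
| db_sym A B (u v : db_hom A B) : db_eq u v -> db_eq v u
| db_trans A B (u v w : db_hom A B) : db_eq u v -> db_eq v w -> db_eq u w
| db_comp_congr A B C (u u' : db_hom B C) (v v' : db_hom A B) :
    db_eq u u' -> db_eq v v' -> db_eq (db_comp u v) (db_comp u' v')
| db_compA A B C D (u : db_hom C D) (v : db_hom B C) (w : db_hom A B) :
    db_eq (db_comp u (db_comp v w)) (db_comp (db_comp u v) w)
| db_comp1l A B (u : db_hom A B) : db_eq (db_comp (db_id B) u) u
| db_comp1r A B (u : db_hom A B) : db_eq (db_comp u (db_id A)) u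
| db_map_ext A B (f g : cmap A B) :
    (forall i x, f i x = g i x) -> db_eq (db_map f) (db_map g)
| db_map_comp A B C (g : cmap B C) (f : cmap A B) :
    db_eq (db_map (comp_cmap g f)) (db_comp (db_map g) (db_map f))
| db_invl A B (s : cmap A B) (qs : quasi_iso s) :
    db_eq (db_comp (db_inv qs) (db_map s)) (db_id A)
| db_invr A B (s : cmap A B) (qs : quasi_iso s) :
    db_eq (db_comp (db_map s) (db_inv qs)) (db_id B).

Definition db_is_iso (A B : cpx) (u : db_hom A B) : Prop :=
  exists v : db_hom B A,
    db_eq (db_comp v u) (db_id A) /\ db_eq (db_comp u v) (db_id B).

Definition db_iso (A B : cpx) : Prop := exists u : db_hom A B, db_is_iso u.

Fixpoint db_shift (n : int) (A B : cpx) (u : db_hom A B) :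
    db_hom (shift A n) (shift B n) :=
  match u with
  | db_map _ _ f => db_map (shift_cmap f n)
  | db_inv _ _ _ qs => db_inv (shift_quasi_iso n qs)
  | db_comp _ _ _ v w => db_comp (db_shift n v) (db_shift n w)
  end.

(* X -u-> Y -v-> Z -w-> X[1] is isomorphic to the standard triangle
   A -f-> B -> cone f -> A[1] of a chain map f *)
Definition exact_triangle (X Y Z : cpx) (u : db_hom X Y) (v : db_hom Y Z)
    (w : db_hom Z (shift X 1)) : Prop :=
  exists (A B : cpx) (f : cmap A B) (a : db_hom X A) (b : db_hom Y B)
         (c : db_hom Z (cone f)),
  [/\ [/\ db_is_iso a, db_is_iso b & db_is_iso c],
      db_eq (db_comp b u) (db_comp (db_map f) a),
      db_eq (db_comp c v) (db_comp (db_map (cone_in f)) b)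
    & db_eq (db_comp (db_shift 1 a) w) (db_comp (db_map (cone_out f)) c)].

Definition star (P Q : cpx -> Prop) (M : cpx) : Prop :=
  exists (X Y : cpx) (u : db_hom X M) (v : db_hom M Y)
         (w : db_hom Y (shift X 1)),
  [/\ P X, Q Y & exact_triangle u v w].

Definition db_add : (cpx -> Prop) -> cpx -> Prop := add db_iso cpx0 cpx_sum.

(* <P> = add {X[i] | X in P, i in Z} *)
Definition gen1 (P : cpx -> Prop) : cpx -> Prop :=
  db_add (fun M => exists2 X, P X & exists i : int, db_iso (shift X i) M).

(* P * ... * P with n.+1 factors *)
Fixpoint star_pow (P : cpx -> Prop) (n : nat) : cpx -> Prop :=
  if n is m.+1 then star P (star_pow P m) else P.

(* <P>_{n.+1} *)
Definition genS (P : cpx -> Prop) (n : nat) : cpx -> Prop :=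
  db_add (star_pow (gen1 P) n).

Definition tri_dim (P : cpx -> Prop) : \bar int :=
  einfn (fun n => forall M : cpx, genS P n M).

(* A subcategory of mod R, viewed in the derived category in degree 0 *)
Definition in_degree0 (P : fgmod R -> Prop) (M : cpx) : Prop :=
  exists2 X, P X & db_iso (stalk X) M.

End Complexes.

(* Main.v *)
Require Import Defs.
From HB Require Import structures.
From mathcomp Require Import all_boot all_order all_algebra.
From mathcomp Require Import boolp constructive_ereal zify.

(* Let d = inj.dim T and n = max(1, d).  A submodule of a projective module
   has no Ext^j(-, T) for j >= n.  Any bounded complex M is isomorphic in the
   derived category to a complex whose terms are submodules of projectives:
   take a contractible complex P of projectives mapping onto M; its kernel K
   has K[1] = M.  So we may assume that Ext^j(-, T) vanishes for j > k := n -
   1 on all cocycle and coboundary modules of M.  If k > 0, choose P -> M with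
   P the sum of a complex F of projectives with zero differential and a
   contractible complex of projectives, surjective on terms and on cocycles.
   The cocycles and coboundaries of the kernel K are first syzygies of those
   of M, so K[1] has bound k - 1, and the triangle P -> M -> K[1] has P = F in
   <X_T>.  If k = 0, the triangle Z -> M -> B[1] of cocycles and coboundaries,
   both with zero differential and terms in X_T, finishes in two steps; this
   makes k + 2 = n + 1 factors in all. *)

Set Implicit Arguments.
Unset Strict Implicit.
Unset Printing Implicit Defensive.

Import Order.TTheory GRing.Theory Num.Theory.
Local Open Scope ring_scope.

(** * Submodules and noetherian rings *)

Section Submodules.
Variable R : pzRingType.

Definition linear_map (U V : lmodType R) (f : U -> V) (f_lin : linear f) :
    {linear U -> V} :=
  HB.pack f (GRing.isLinear.Build R U V *:%R f f_lin).

Lemma ker0_inj (U V : lmodType R) (f : {linear U -> V}) :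
  (forall x, f x = 0 -> x = 0) -> injective f.
Proof.
move=> kerf x y fxy; apply/eqP; rewrite -subr_eq0; apply/eqP/kerf.
by rewrite linearB fxy subrr.
Qed.

Record submodule (V : lmodType R) := Submodule {
  in_submodule :> V -> Prop;
  submodule0 : in_submodule 0;
  submoduleD : forall x y, in_submodule x -> in_submodule y ->
    in_submodule (x + y);
  submoduleZ : forall a x, in_submodule x -> in_submodule (a *: x) }.

Lemma submoduleB (V : lmodType R) (S : submodule V) x y :
  S x -> S y -> S (x - y).
Proof.
by move=> Sx Sy; apply: submoduleD => //; rewrite -scaleN1r; apply: submoduleZ.
Qed.

Lemma submodule_sum (V : lmodType R) (S : submodule V) n (a : 'I_n -> R)
    (e : 'I_n -> V) : (forall i, S (e i)) -> S (\sum_i a i *: e i).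
Proof.
move=> Se; apply: (big_ind S) => [|x y|i _]; first exact: submodule0.
  exact: submoduleD.
exact: submoduleZ.
Qed.

(** The boolean form of membership, needed to make a submodule a module in its own right as a
    subtype. *)
Definition submodule_pred (V : lmodType R) (S : submodule V) : {pred V} :=
  fun x => `[< S x >].

Lemma submodule_pred_closed V (S : submodule V) :
  submod_closed (submodule_pred S).
Proof.
split=> [|a x y /asboolP Sx /asboolP Sy]; apply/asboolP.
  exact: submodule0.
by apply: submoduleD => //; apply: submoduleZ.
Qed.

HB.instance Definition _ V (S : submodule V) :=
  GRing.isSubmodClosed.Build R V (submodule_pred S) (submodule_pred_closed S).

Record submodule_type (V : lmodType R) (S : submodule V) := SubmoduleElt {
  submodule_val : V;
  _ : submodule_val \in submodule_pred S }.

HB.instance Definition _ V (S : submodule V) :=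
  [isSub for @submodule_val V S].
HB.instance Definition _ V (S : submodule V) :=
  [Choice of submodule_type S by <:].
HB.instance Definition _ V (S : submodule V) :=
  [SubChoice_isSubLmodule of submodule_type S by <:].

Definition submodule_incl V (S : submodule V) :
  {linear submodule_type S -> V} := val.

Lemma submodule_incl_inj V (S : submodule V) : injective (submodule_incl S).
Proof. exact: val_inj. Qed.

Lemma submodule_inclP V (S : submodule V) x :
  (exists w, submodule_incl S w = x) <-> S x.
Proof.
split=> [[[w Sw] <-]|Sx]; first exact/asboolP.
have Sx' : x \in submodule_pred S by apply/asboolP.
by exists (SubmoduleElt Sx').
Qed.

Lemma submodule_incl_mem V (S : submodule V) w : S (submodule_incl S w).
Proof. by apply/submodule_inclP; exists w. Qed.

Lemma factor_inj (U V W : lmodType R) (i : {linear W -> V})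
    (f : {linear U -> V}) :
  injective i -> (forall u, exists w, i w = f u) ->
  exists g : {linear U -> W}, forall u, i (g u) = f u.
Proof.
move=> i_inj /choice[g gE].
have g_lin : linear g by move=> a u v; apply: i_inj;
  rewrite linearP !gE linearP.
by exists (linear_map g_lin).
Qed.

Definition lin_kernel (V W : lmodType R) (f : {linear V -> W}) : submodule V.
Proof.
refine (@Submodule V (fun x => f x = 0) _ _ _); first exact: linear0.
  by move=> x y fx fy; rewrite linearD fx fy addr0.
by move=> a x fx; rewrite linearZ /= fx scaler0.
Defined.

Definition lin_image (V W : lmodType R) (f : {linear V -> W}) : submodule W.
Proof.
refine (@Submodule W (fun y => exists x, f x = y) _ _ _).
- by exists 0; rewrite linear0.
- by move=> _ _ [x <-] [y <-]; exists (x + y); rewrite linearD.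
- by move=> a _ [x <-]; exists (a *: x); rewrite linearZ.
Defined.

Definition meet_submodule (V : lmodType R) (S S' : submodule V) : submodule V.
Proof.
refine (@Submodule V (fun x => S x /\ S' x) _ _ _).
- by split; apply: submodule0.
- by move=> x y [Sx S'x] [Sy S'y]; split; apply: submoduleD.
- by move=> a x [Sx S'x]; split; apply: submoduleZ.
Defined.

Definition span_submodule (V : lmodType R) n (e : 'I_n -> V) : submodule V.
Proof.
refine (@Submodule V (fun x => exists a, x = \sum_i a i *: e i) _ _ _).
- by exists (fun=> 0); rewrite big1 // => i _; rewrite scale0r.
- move=> _ _ [a ->] [b ->]; exists (fun i => a i + b i).
  by rewrite -big_split; apply: eq_bigr => i _; rewrite scalerDl.
- move=> c _ [a ->]; exists (fun i => c * a i).
  by rewrite scaler_sumr; apply: eq_bigr => i _; rewrite scalerA.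
Defined.

Section Noetherian.
Hypothesis R_noeth : left_noetherian R.

(** Induction on the number of generators of the ambient span: lifts of generators of the ideal of
    possible coefficients at [e ord0], together with generators of the part of [S] in the span of
    the others, generate [S]. *)
Lemma noetherian_span (V : lmodType R) n (e : 'I_n -> V) (S : submodule V) :
  (forall x, S x -> span_submodule e x) ->
  exists m (s : 'I_m -> V), (forall k, S (s k)) /\
    forall x, S x -> span_submodule s x.
Proof.
elim: n e S => [|n IHn] e S S_span.
  exists 0%N, (fun _ => 0); split=> [[]|x /S_span[a ->]] //.
  by exists (fun=> 0); rewrite !big_ord0.
pose e' i := e (lift ord0 i).
(* The coefficients at [e ord0] of elements of [S], modulo the span of the remaining generators. *)
pose I r := exists2 x, S x & span_submodule e' (x - r *: e ord0).
have I_ideal : left_ideal I.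
  split=> [|r r' [x Sx xr] [x' Sx' xr']|a r [x Sx xr]].
  - by exists 0; rewrite ?scale0r ?subr0; apply: submodule0.
  - exists (x + x'); first exact: submoduleD.
    by rewrite scalerDl opprD addrACA; apply: submoduleD.
  - exists (a *: x); first exact: submoduleZ.
    by rewrite -scalerA -scalerBr; apply: submoduleZ.
have [m [r [Ir r_gen]]] := R_noeth I_ideal.
have [x xP] := choice (fun k => let: ex_intro2 x Sx xr := Ir k in
  ex_intro (fun x => S x /\ span_submodule e' (x - r k *: e ord0))
    x (conj Sx xr)).
have [m' [s' [Ss' s'_gen]]] :=
  IHn e' (meet_submodule S (span_submodule e')) (fun x Sx => Sx.2).
exists (m + m')%N, (fun k => match split k with
  inl i => x i | inr j => s' j end); split=> [k|y Sy].
  by case: (split k) => [i|j]; [case: (xP i) | case: (Ss' j)].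
have [a ya] := S_span y Sy.
have Ia : I (a ord0).
  exists y => //; rewrite ya big_ord_recl addrC addKr.
  by exists (fun i => a (lift ord0 i)).
have [b ab] := r_gen _ Ia.
have [|c yc] := s'_gen (y - \sum_i b i *: x i).
  split; first by apply: submoduleB Sy (submodule_sum _ _) => k; case: (xP k).
  (* The multiples of [e ord0] cancel because [a ord0] is the combination of the [r i] with
     coefficients [b i]; both remaining terms lie in the span of [e']. *)
  have -> : y - \sum_i b i *: x i =
      (y - a ord0 *: e ord0) - \sum_i b i *: (x i - r i *: e ord0).
    rewrite [in RHS](eq_bigr (fun i => b i *: x i - (b i * r i) *: e ord0));
      last first.
      by move=> i _; rewrite scalerBr scalerA.
    rewrite sumrB -scaler_suml -ab opprB.
    by rewrite [RHS]addrA subrK.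
  apply: submoduleB; last by apply: submodule_sum => k; case: (xP k).
  rewrite ya big_ord_recl addrC addKr.
  by exists (fun i => a (lift ord0 i)).
exists (fun k => match split k with inl i => b i | inr j => c j end).
rewrite big_split_ord /=.
have El (i : 'I_m) : split (lshift m' i) = inl i by exact: (unsplitK (inl i)).
have Er (j : 'I_m') : split (rshift m j) = inr j by exact: (unsplitK (inr j)).
under eq_bigr do rewrite El.
under [X in _ = _ + X]eq_bigr do rewrite Er.
by rewrite -yc addrC subrK.
Qed.

Lemma fg_submodule (V : fgmod R) (S : submodule V) :
  finitely_generated (submodule_type S).
Proof.
have [n [e e_gen]] := fgmodP V.
have [m [s [Ss s_gen]]] := @noetherian_span V n e S (fun x _ => e_gen x).
have [t tE] := choice (fun k => (submodule_inclP S (s k)).2 (Ss k)).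
exists m, t => w; have [a wE] := s_gen _ (submodule_incl_mem w).
exists a; apply: submodule_incl_inj; rewrite wE linear_sum.
by apply: eq_bigr => k _; rewrite linearZ tE.
Qed.

Definition fg_sub (V : fgmod R) (S : submodule V) : fgmod R :=
  FgMod (fg_submodule S).

End Noetherian.

End Submodules.

(** * Projective modules and Ext *)

Section Ext.
Variable R : pzRingType.
Implicit Types K M N P Q U V W I : lmodType R.

(** Corestricting [p] and [f] to the image of [p] makes [p] surjective. *)
Lemma projective_lift P M N (p : {linear M -> N}) (f : {linear P -> N}) :
  projective P -> (forall x, exists y, p y = f x) ->
  exists g : {linear P -> M}, forall x, p (g x) = f x.
Proof.
move=> projP pf; pose im := lin_image p.
have [p' p'E] : exists p' : {linear M -> submodule_type im},
    forall x, submodule_incl im (p' x) = p x.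
  apply: factor_inj => [|u]; first exact: submodule_incl_inj.
  by apply/submodule_inclP; exists u.
have [f' f'E] : exists f' : {linear P -> submodule_type im},
    forall x, submodule_incl im (f' x) = f x.
  by apply: factor_inj => [|u];
    [exact: submodule_incl_inj|exact/submodule_inclP].
have [|g gE] := projP _ _ p' f'.
  move=> y; have [x xE] := submodule_incl_mem y.
  by exists x; apply: submodule_incl_inj; rewrite p'E.
by exists g => x; rewrite -p'E gE f'E.
Qed.

Lemma projective_prod P P' :
  projective P -> projective P' -> projective (P * P')%type.
Proof.
move=> projP projP' M N p f p_surj.
have f1_lin : linear (fun x : P => f (x, 0)).
  move=> a x y; rewrite -linearP; congr (f _).
  by apply: injective_projections; rewrite //= scaler0 addr0.
have f2_lin : linear (fun x : P' => f (0, x)).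
  move=> a x y; rewrite -linearP; congr (f _).
  by apply: injective_projections; rewrite //= scaler0 addr0.
have [g1 g1E] := projP _ _ p (linear_map f1_lin) p_surj.
have [g2 g2E] := projP' _ _ p (linear_map f2_lin) p_surj.
have g_lin : linear (fun x : P * P' => g1 x.1 + g2 x.2).
  by move=> a x y; rewrite /= !linearP scalerDr addrACA.
exists (linear_map g_lin) => -[x y] /=; rewrite linearD g1E g2E /= -linearD.
by congr (f _); apply: injective_projections; rewrite /= ?addr0 ?add0r.
Qed.

Definition lincomb n M (e : 'I_n -> M) (v : 'rV[R]_n) : M :=
  \sum_i v 0 i *: e i.

Lemma lincomb_linear n M (e : 'I_n -> M) : linear (lincomb e).
Proof.
move=> a u v; rewrite /lincomb scaler_sumr -big_split.
by apply: eq_bigr => i _; rewrite !mxE scalerDl scalerA.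
Qed.

Lemma linear_rV n M (f : {linear 'rV[R]_n -> M}) v :
  f v = lincomb (fun i => f (delta_mx 0 i)) v.
Proof.
by rewrite [v in LHS]row_sum_delta linear_sum; apply: eq_bigr => i _;
  rewrite linearZ.
Qed.

Lemma projective_rV n : projective 'rV[R]_n.
Proof.
move=> M N p f p_surj.
have [e eE] := choice (fun i => p_surj (f (delta_mx 0 i))).
exists (linear_map (lincomb_linear e)) => v;
  rewrite [RHS]linear_rV /= linear_sum.
by apply: eq_bigr => i _; rewrite linearZ eE.
Qed.

Lemma fg_rV n : finitely_generated 'rV[R]_n.
Proof.
by exists n, (fun i => delta_mx 0 i) => v; exists (v 0); exact: row_sum_delta.
Qed.

Lemma Ext_projective P N i : projective P -> (0 < i)%N -> Ext_eq0 i P N.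
Proof.
case: i => // n projP _ Q d eps [projQ eps_surj eps_ker d_ker] g gd.
(* A resolution of a projective module splits: a partial contraction [s] is built degree by degree,
   each one lifting the identity minus the previous splitting. *)
have [s sE] : exists s : {linear Q n -> Q n.+1},
    forall x, d n (s (d n x)) = d n x.
  elim: n {g gd} => [|n [s sE]].
    have [t tE] := projective_lift (f := idfun) projP eps_surj.
    pose f : {linear Q 0%N -> Q 0%N} := idfun \- (t \o eps).
    have [|s sE] := projective_lift (p := d 0%N) (f := f) (projQ _).
      by move=> x; apply/eps_ker; rewrite /f /= linearB tE subrr.
    exists s => x; rewrite sE /f /=.
    have -> : eps (d 0%N x) = 0 by apply/eps_ker; exists x.
    by rewrite linear0 subr0.
  pose f : {linear Q n.+1 -> Q n.+1} := idfun \- (s \o d n).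
  have [|t tE] := projective_lift (p := d n.+1) (f := f) (projQ _).
    by move=> x; apply/d_ker; rewrite /f /= linearB sE subrr.
  exists t => x; rewrite tE /f /=.
  have -> : d n (d n.+1 x) = 0 by apply/d_ker; exists x.
  by rewrite linear0 subr0.
(* The element [x - s (d n x)] is killed by [d n], hence is a boundary, on which [g] vanishes. *)
exists (g \o s) => x /=; apply/eqP; rewrite -subr_eq0 -linearB; apply/eqP.
have [|y <-] := (d_ker n (x - s (d n x))).1; last exact: gd.
by rewrite linearB sE subrr.
Qed.

(** Since [f] kills the kernel of [a], it induces a map on the image of [a], which extends to [V] by
    injectivity. *)
Lemma injective_extend I U V (a : {linear U -> V}) (f : {linear U -> I}) :
  injective_module I -> (forall u, a u = 0 -> f u = 0) ->
  exists g : {linear V -> I}, forall u, g (a u) = f u.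
Proof.
move=> injI af; pose im := lin_image a.
have [f' f'E] := choice (fun w : submodule_type im => submodule_incl_mem w).
have ff' w u : submodule_incl im w = a u -> f u = f (f' w).
  move=> wu; apply/eqP; rewrite -subr_eq0 -linearB; apply/eqP/af.
  by rewrite linearB f'E wu subrr.
have g_lin : linear (f \o f').
  move=> c w w'; rewrite /= -linearP; apply/esym/ff'.
  by rewrite !linearP !f'E.
have [g gE] := injI _ _ (submodule_incl im) (linear_map g_lin)
  (@submodule_incl_inj _ _ im).
exists g => u; have [|w wE] := (submodule_inclP im (a u)).2; first by exists u.
by rewrite -wE gE; apply/esym/ff'.
Qed.

(** Dimension shift in the second variable, by induction on [d]: the cokernel of [N -> I 0] has
    injective dimension one less, and the question for it sits one degree lower in [P]. The complex
    [P] is exact in positive degrees, so its cohomology with values in [N] is an Ext of the cokernel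
    of [dP 0]. *)
Lemma injdim_vanish N d (P : nat -> lmodType R)
    (dP : forall n, {linear P n.+1 -> P n}) :
  injdim_le N d -> (forall n, projective (P n)) ->
  (forall n x, dP n x = 0 <-> exists y, dP n.+1 y = x) ->
  forall n, (d <= n)%N -> forall g : {linear P n.+1 -> N},
  (forall x, g (dP n.+1 x) = 0) ->
  exists h : {linear P n -> N}, forall x, g x = h (dP n x).
Proof.
move=> dN projP exP; elim: d N dN => [|d IHd] N.
  (* Base case: [I 1] is zero, so [eta] is onto and [N] is injective. *)
  case=> [I [eta [dI [injI I0 eta_inj eta_ker dI_ker]]]] n _ g gd.
  have etag u : dP n u = 0 -> (eta \o g) u = 0.
    by case/exP=> x <- /=; rewrite gd linear0.
  have [h hE] := injective_extend (injI 0%N) etag.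
  have [|k kE] := factor_inj (f := h) eta_inj.
    by move=> x; apply/eta_ker/I0.
  by exists k => x; apply: eta_inj; rewrite kE hE.
case=> [I [eta [dI [injI I0 eta_inj eta_ker dI_ker]]]] [//|n] dn g gd.
have etag u : dP n.+1 u = 0 -> (eta \o g) u = 0.
  by case/exP=> x <- /=; rewrite gd linear0.
have [h hE] := injective_extend (injI 0%N) etag.
(* By exactness this is also the image of [dI 0], that is, the cokernel of [eta]. *)
pose N' := lin_kernel (dI 1%N); pose i := submodule_incl N'.
have dN' : injdim_le (submodule_type N') d.
  exists (fun k => I k.+1), i, (fun k => dI k.+1); split=> //.
  - by move=> k dk; apply: I0.
  - exact: submodule_incl_inj.
  - by move=> x; split=> [?|[w <-]];
    [apply/submodule_inclP|exact: (submodule_incl_mem w)].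
have [|g1 g1E] := factor_inj (i := i) (f :=
  dI 0%N \o h) (@submodule_incl_inj _ _ N').
  by move=> u; apply/submodule_inclP/dI_ker; exists (h u).
have [||h1 h1E] := IHd _ dN' n _ g1; first by [].
  move=> x; apply: (@submodule_incl_inj _ _ N').
  by rewrite [RHS]linear0 [LHS]g1E /= hE; apply/eta_ker; exists (g x).
have [|h2 h2E] := projective_lift (p := dI 0%N) (f := i \o h1) (projP n).
  by move=> x; apply/dI_ker/(submodule_incl_mem (h1 x)).
(* Subtracting [h2 \o dP n] pushes [h] into the kernel of [dI 0], which is [N], without changing its
   composite with [dP n.+1]. *)
have [|h3 h3E] := factor_inj (f := h \- (h2 \o dP n)) eta_inj.
  move=> x; apply/eta_ker; have dh : dI 0%N (h x) = i (h1 (dP n x)).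
    by rewrite -h1E g1E.
  by rewrite [LHS]linearB dh h2E subrr.
exists h3 => x; apply: eta_inj; rewrite h3E /= hE.
have -> : dP n (dP n.+1 x) = 0 by apply/exP; exists x.
by rewrite linear0 subr0.
Qed.

Section Splice.
Variables (Q K : lmodType R) (P : nat -> lmodType R).
Variables (d : forall n, {linear P n.+1 -> P n}).
Variables (eps : {linear P 0%N -> K}) (a : {linear K -> Q}).
Hypotheses (projQ : projective Q) (a_inj : injective a).
Hypothesis resP : projective_resolution d eps.

(** A resolution of [K] moved up one degree, with [Q] placed in degree 0: for [K] inside [Q] it
    resolves [Q / K]. *)
Definition splice_term n := if n is m.+1 then P m else Q.

Definition splice_diff n : {linear splice_term n.+1 -> splice_term n} :=
  match n return {linear splice_term n.+1 -> splice_term n} with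
  | 0 => a \o eps
  | m.+1 => d m
  end.

Lemma splice_projective n : projective (splice_term n).
Proof. by case: resP => projP _ _ _; case: n. Qed.

Lemma splice_exact n x :
  splice_diff n x = 0 <-> exists y, splice_diff n.+1 y = x.
Proof.
case: resP => _ _ eps_ker d_ker; case: n x => [|n] x; last exact: d_ker.
apply: iff_trans (eps_ker x) => /=; split=> [|->]; last exact: linear0.
by rewrite -(linear0 a) => /a_inj.
Qed.

End Splice.

(** Splicing identifies Ext in degree [j] of [K] with Ext in degree [j + 1] of [Q / K], which
    vanishes once [j + 1] exceeds [d]; the 1 in the maximum keeps [j] positive. *)
Lemma Ext_sub_projective N d K Q (a : {linear K -> Q}) j :
  injdim_le N d -> projective Q -> injective a -> (maxn 1 d <= j)%N ->
  Ext_eq0 j K N.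
Proof.
move=> dN projQ a_inj; case: j => [|n]; first by rewrite leqNgt leq_max.
rewrite geq_max => /andP[_ dn] P dP eps resP.
exact: (injdim_vanish dN (splice_projective projQ resP)
  (splice_exact a_inj resP) dn).
Qed.

(** Dimension shift in the first variable: every resolution of [K] splices to one of [M]. *)
Lemma Ext_syzygy N K Q M (a : {linear K -> Q}) (b : {linear Q -> M}) j :
  projective Q -> injective a -> (forall y, exists x, b x = y) ->
  (forall x, b x = 0 <-> exists y, a y = x) -> (0 < j)%N ->
  Ext_eq0 j.+1 M N -> Ext_eq0 j K N.
Proof.
move=> projQ a_inj b_surj b_ker; case: j => // n _ extM P dP eps resP.
have resQ : projective_resolution (splice_diff dP eps a) b.
  split=> //; [exact: splice_projective resP| |exact: splice_exact].
  move=> x; rewrite b_ker; case: resP => _ eps_surj _ _.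
  split=> [[y <-]|[y <-]]; last by exists (eps y).
  by have [z <-] := eps_surj y; exists z.
exact: (extM _ _ _ resQ).
Qed.

End Ext.

(** * Isomorphisms and triangles in the derived category *)

Section Derived.
Variable R : pzRingType.
Implicit Types A B C M Y : cpx R.

Lemma db_iso_refl A : db_iso A A.
Proof.
by exists (db_id A), (db_id A); split; apply: db_comp1l.
Qed.

Lemma db_iso_sym A B : db_iso A B -> db_iso B A.
Proof. by case=> u [v [vu uv]]; exists v, u. Qed.

Lemma db_comp_cancel A B C (u : db_hom A B) (u' : db_hom B A)
    (v : db_hom B C) (v' : db_hom C B) :
  db_eq (db_comp u' u) (db_id A) -> db_eq (db_comp v' v) (db_id B) ->
  db_eq (db_comp (db_comp u' v') (db_comp v u)) (db_id A).
Proof.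
move=> u'u v'v; apply: db_trans u'u.
apply: db_trans (db_sym (db_compA _ _ _)) _; apply: db_comp_congr (db_refl _) _.
apply: db_trans (db_compA _ _ _) _; apply: db_trans (db_comp1l u).
exact: db_comp_congr v'v (db_refl _).
Qed.

Lemma db_iso_trans B A C : db_iso A B -> db_iso B C -> db_iso A C.
Proof.
case=> u [u' [u'u uu']] [v [v' [v'v vv']]].
by exists (db_comp v u), (db_comp u' v'); split; apply: db_comp_cancel.
Qed.

Lemma quasi_iso_db_iso A B (f : cmap A B) : quasi_iso f -> db_iso A B.
Proof.
by move=> qf; exists (db_map f), (db_inv qf); split;
  [apply: db_invl|apply: db_invr].
Qed.

(** The standard triangle of [f], with the cone replaced by the isomorphic [Y]. *)
Lemma star_cone (P Q : cpx R -> Prop) A M Y (f : cmap A M) :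
  P A -> Q Y -> db_iso Y (cone f) -> star P Q M.
Proof.
move=> PA QY [c [c' [c'c cc']]].
exists A, Y, (db_map f), (db_comp c' (db_map (cone_in f))),
  (db_comp (db_map (cone_out f)) c); split=> //.
exists A, M, f, (db_id A), (db_id M), c.
have id_iso B : db_is_iso (db_id B) by exists (db_id B); split;
  apply: db_comp1l.
split; first by split=> //; exists c'.
- exact: db_trans (db_comp1l _) (db_sym (db_comp1r _)).
- apply: db_trans (db_compA _ _ _) _.
  apply: db_trans (db_comp_congr cc' (db_refl _)) _.
  exact: db_trans (db_comp1l _) (db_sym (db_comp1r _)).
(* The shift of the identity agrees with the identity pointwise, hence [db_map_ext]. *)
- apply: db_trans (db_comp1l _).
  by apply: db_comp_congr (db_refl _); apply: db_map_ext.
Qed.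

Lemma coboundary0 A i : coboundary (0 : A i).
Proof. by exists i, 0; apply: linear0. Qed.

Lemma coboundary_succ A j (x : A (j + 1)) :
  coboundary x <-> exists y, diff A j (j + 1) y = x.
Proof.
split=> [[k [y yx]]|[y yx]]; last by exists j, y.
have [jk|jk] := eqVneq j k; first by subst k; exists y.
exists 0; rewrite linear0 -yx diff_shape //.
by rewrite (inj_eq (addIr _)).
Qed.

Lemma cocycle_succ A i (x : A i) : diff A i (i + 1) x = 0 -> cocycle x.
Proof.
by move=> dx k; have [->|ki] := eqVneq k (i + 1); last exact: diff_shape.
Qed.

Lemma coboundary_cocycle A i (x : A i) : coboundary x -> cocycle x.
Proof. by case=> j [y <-] k; apply: diff_diff. Qed.

Lemma bijective_quasi_iso A B (f : cmap A B) :
  (forall i, bijective (f i)) -> quasi_iso f.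
Proof.
move=> bij_f i; split=> [z _ [j [y yE]]|w cw].
  have [g fg gf] := bij_f j; exists j, (g y).
  by apply: (bij_inj (bij_f i)); rewrite -cmap_diff gf.
have [g fg gf] := bij_f i; exists (g w) => [k|].
  by apply: (bij_inj (bij_f k)); rewrite -cmap_diff gf cw linear0.
by rewrite gf subrr; apply: coboundary0.
Qed.

Definition bounded_family (X : int -> fgmod R) : Prop :=
  exists N : nat, forall i, (N < `|i|)%N -> forall x : X i, x = 0.

Section ZeroDifferential.
Variables (X : int -> fgmod R) (X_bounded : bounded_family X).

Definition zero_diff i j : {linear X i -> X j} := \0.

Lemma zero_diff_shape i j (x : X i) : j != i + 1 -> zero_diff i j x = 0.
Proof. by []. Qed.

Lemma zero_diff_diff i j k (x : X i) : zero_diff j k (zero_diff i j x) = 0.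
Proof. by []. Qed.

Definition zero_diff_cpx : cpx R :=
  Cpx zero_diff_shape zero_diff_diff X_bounded.

End ZeroDifferential.

Lemma zero_diff_iso A B :
  (forall i j x, diff A i j x = 0) -> (forall i j x, diff B i j x = 0) ->
  (forall i, exists f : {linear A i -> B i}, bijective f) -> db_iso A B.
Proof.
move=> dA dB AB; pose f i := sval (cid (AB i)).
have f_diff i j x : diff B i j (f i x) = f j (diff A i j x).
  by rewrite dA dB linear0.
apply: (@quasi_iso_db_iso _ _ (CMap f_diff)).
by apply: bijective_quasi_iso => i; apply: (svalP (cid (AB i))).
Qed.

Lemma gen1_iso (P : cpx R -> Prop) A B : db_iso A B -> gen1 P A -> gen1 P B.
Proof. exact: add_iso. Qed.

(** Induction on a list supporting [X]: degree [j] is split off as a shifted stalk, and the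
    complement [X'] has zero in that degree. *)
Lemma gen1_zero_diff_seq (P : fgmod R -> Prop) (s : seq int)
    (X : int -> fgmod R) (X_bounded : bounded_family X) :
  (forall i, i \in s -> P (X i)) ->
  (forall i, i \notin s -> forall x : X i, x = 0) ->
  gen1 (in_degree0 P) (zero_diff_cpx X_bounded).
Proof.
elim: s X X_bounded => [|j s IHs] X X_bounded PX X0.
  apply: gen1_iso (add_zero _ _ _ _); apply: zero_diff_iso => // i.
  exists \0; exists (fun=> 0) => x; last exact/esym/X0.
  by move: x; rewrite /= /stalk_term; case: (i == 0) => x; apply/rowP => -[].
(* A repeated degree is dropped, so that [X j] is split off once only. *)
have [js|js] := boolP (j \in s).
  apply: IHs => i si; first by apply: PX; rewrite inE si orbT.
  by apply: X0; rewrite inE negb_or si andbT; apply: contraNneq si => ->.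
pose X' i := if i == j then fg0 R else X i.
have X'_bounded : bounded_family X'.
  have [N XN] := X_bounded; exists N => i Ni; rewrite /X'.
  by case: (i == j) => x; [apply/rowP => -[]|apply: XN].
have gX' : gen1 (in_degree0 P) (zero_diff_cpx X'_bounded).
  apply: IHs => i si; rewrite /X'.
    have -> : i == j = false by apply: contraNF js => /eqP<-.
    by apply: PX; rewrite inE si orbT.
  case: eqP => [_ x|/eqP ij]; first by apply/rowP => -[].
  by apply: X0; rewrite inE negb_or ij.
have gXj : gen1 (in_degree0 P) (shift (stalk (X j)) (- j)).
  apply: add_in; exists (stalk (X j)).
    by exists (X j); [apply: PX; rewrite inE eqxx|apply: db_iso_refl].
  by exists (- j); apply: db_iso_refl.
apply: gen1_iso (add_sum gXj gX'); apply: zero_diff_iso => // [i k x|i].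
  rewrite /= /sum_diff_fun /= /shift_diff.
  by case: ifP => _; apply: injective_projections; rewrite //= oppr0.
rewrite /= /shift_term /= /stalk_term /X' subr_eq0; case: eqP => [->|_].
  exists fst, (fun y => (y, 0)) => [[x y]|//].
  by congr pair; apply/rowP => -[].
exists snd, (fun y => (0, y)) => [[x y]|//].
by congr pair; apply/rowP => -[].
Qed.

Lemma gen1_zero_diff (P : fgmod R -> Prop) (X : int -> fgmod R)
    (X_bounded : bounded_family X) :
  (forall i, P (X i)) -> gen1 (in_degree0 P) (zero_diff_cpx X_bounded).
Proof.
move=> PX; have [N XN] := X_bounded.
(* The integers from [-N] to [N]. *)
pose s : seq int := [seq (n%:Z - N%:Z)%R | n <- iota 0 (N + N).+1].
apply: (gen1_zero_diff_seq (s := s)) => // i si; apply: XN.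
rewrite ltnNge; apply: contra si => iN; apply/mapP; exists (absz (i + N%:Z)).
  by rewrite mem_iota /=; lia.
by lia.
Qed.

End Derived.

(** * Kernels of surjective chain maps *)

Section KernelComplex.
Variable R : pzRingType.
Hypothesis R_noeth : left_noetherian R.

(** The cast in [cone_conn] disappears because equality proofs between integers are unique. *)
Lemma cone_conn_succ (A B : cpx R) (f : cmap A B) i x :
  cone_conn f i (i + 1) x = f (i + 1) x.
Proof. by rewrite /cone_conn; case: eqP => // e; rewrite eq_axiomK. Qed.

Lemma cone_diff_succ (A B : cpx R) (f : cmap A B) i p :
  diff (cone f) i (i + 1) p =
  (- diff A (i + 1) (i + 1 + 1) p.1, f (i + 1) p.1 + diff B i (i + 1) p.2).
Proof. by rewrite -cone_conn_succ. Qed.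

Lemma shift1_diff (A : cpx R) i j (x : A (i + 1)) :
  diff (shift A 1) i j x = - diff A (i + 1) (j + 1) x.
Proof. by []. Qed.

Variables (P M : cpx R) (p : cmap P M).

Definition ker_term i : fgmod R := fg_sub R_noeth (lin_kernel (p i)).

Definition ker_incl_at i : {linear ker_term i -> P i} :=
  submodule_incl (lin_kernel (p i)).

Lemma ker_incl_inj i : injective (@ker_incl_at i).
Proof. exact: submodule_incl_inj. Qed.

Lemma ker_inclP i x : (exists w, @ker_incl_at i w = x) <-> p i x = 0.
Proof. exact: submodule_inclP. Qed.

Lemma ker_incl_ker i w : p i (@ker_incl_at i w) = 0.
Proof. by apply/ker_inclP; exists w. Qed.

Lemma ker_diff_exists i j : exists g : {linear ker_term i -> ker_term j},
  forall w, ker_incl_at j (g w) = diff P i j (ker_incl_at i w).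
Proof.
apply: (factor_inj (f := diff P i j \o ker_incl_at i)) => [|w].
  exact: ker_incl_inj.
by apply/ker_inclP; rewrite /= -cmap_diff ker_incl_ker linear0.
Qed.

Definition ker_diff i j := sval (cid (ker_diff_exists i j)).

Lemma ker_diffE i j w :
  ker_incl_at j (ker_diff i j w) = diff P i j (ker_incl_at i w).
Proof. exact: (svalP (cid (ker_diff_exists i j))). Qed.

Lemma ker_shape i j w : j != i + 1 -> ker_diff i j w = 0.
Proof.
by move=> ji; apply: ker_incl_inj; rewrite ker_diffE diff_shape // linear0.
Qed.

Lemma ker_dd i j k w : ker_diff j k (ker_diff i j w) = 0.
Proof. by apply: ker_incl_inj; rewrite !ker_diffE diff_diff linear0. Qed.

Lemma ker_bounded : bounded_family ker_term.
Proof.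
have [N PN] := cpx_bounded P; exists N => i Ni w.
by apply: ker_incl_inj; rewrite linear0; apply: PN.
Qed.

Definition ker_cpx : cpx R := Cpx ker_shape ker_dd ker_bounded.

Lemma ker_cocycle i (w : ker_cpx i) : cocycle w <-> cocycle (ker_incl_at i w).
Proof.
split=> cw k; first by rewrite -ker_diffE cw linear0.
by apply: ker_incl_inj; rewrite [LHS]ker_diffE cw linear0.
Qed.

Definition ker_cone_at i (w : shift ker_cpx 1 i) : cone p i :=
  (ker_incl_at (i + 1) w, 0).

Lemma ker_cone_linear i : linear (@ker_cone_at i).
Proof.
move=> a x y; apply: injective_projections; first exact: linearP.
by rewrite /= scaler0 addr0.
Qed.

Lemma ker_cone_diff i j w :
  diff (cone p) i j (linear_map (@ker_cone_linear i) w) =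
  linear_map (@ker_cone_linear j) (diff (shift ker_cpx 1) i j w).
Proof.
apply: injective_projections;
  first by rewrite shift1_diff [RHS]linearN [in RHS]ker_diffE.
have [->|ji] := eqVneq j (i + 1).
  by rewrite cone_diff_succ /= ker_incl_ker linear0 addr0.
by rewrite !diff_shape // linear0.
Qed.

Definition ker_cone : cmap (shift ker_cpx 1) (cone p) := CMap ker_cone_diff.

Hypothesis p_surj : forall i y, exists x, p i x = y.

(** As [p] is onto, every pair [(u, m)] in the cone can be changed by a boundary, using a lift of
    [m], into one supported on the kernel. *)
Lemma ker_cone_quasi_iso : quasi_iso ker_cone.
Proof.
(* The degree is written as a successor, so that [coboundary_succ] applies. *)
move=> i; rewrite -(subrK 1 i); move: (i - 1) => {}i; split=> [z cz|w cw].
  case/coboundary_succ=> -[u m]; rewrite cone_diff_succ /= => -[duz um].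
  have [m' m'E] := p_surj m;
    have [|k kE] := (ker_inclP (u + diff P i (i + 1) m')).2.
    by rewrite linearD /= -cmap_diff m'E.
  apply/coboundary_succ; exists k; apply: ker_incl_inj; rewrite shift1_diff.
  by rewrite linearN [in LHS]ker_diffE kE linearD /= diff_diff addr0.
have := cw (i + 1 + 1); rewrite cone_diff_succ; case: w cw => u m cw [du um].
have [m' m'E] := p_surj m.
have [|k kE] := (ker_inclP (u + diff P (i + 1) (i + 1 + 1) m')).2.
  by rewrite linearD /= -cmap_diff m'E.
exists k.
  apply/shift_cocycle/ker_cocycle/cocycle_succ;
    rewrite kE linearD diff_diff addr0.
  by apply/eqP; rewrite -oppr_eq0; apply/eqP.
apply/coboundary_succ; exists (m', 0); rewrite cone_diff_succ.
apply: injective_projections => /=; last by rewrite linear0 addr0 subr0.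
rewrite -[RHS]/(u - ker_incl_at _ k) kE.
by rewrite opprD addrA subrr sub0r.
Qed.

(** In a cocycle [(u, m)] the component [u] is a cocycle of [P], hence [u = d v], and the boundary
    of [(v, 0)] removes it. *)
Lemma cone_in_quasi_iso :
  (forall i (x : P i), cocycle x -> coboundary x) -> quasi_iso (cone_in p).
Proof.
move=> acycP i; rewrite -(subrK 1 i); move: (i - 1) => {}i; split=> [z cz|w cw].
  case/coboundary_succ=> -[u m]; rewrite cone_diff_succ /= => -[/eqP du um].
  have /coboundary_succ[v vu] : coboundary u.
    by apply/acycP/cocycle_succ/eqP; rewrite -oppr_eq0.
  by apply/coboundary_succ; exists (p i v + m); rewrite linearD cmap_diff vu.
have := cw (i + 1 + 1); rewrite cone_diff_succ;
  case: w cw => u m cw [/eqP du um].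
have /coboundary_succ[v vu] : coboundary u.
  by apply/acycP/cocycle_succ/eqP; rewrite -oppr_eq0.
exists (m + p (i + 1) v).
  by apply: cocycle_succ; rewrite linearD /= cmap_diff vu [LHS]addrC.
apply/coboundary_succ; exists (- v, 0); rewrite cone_diff_succ.
apply: injective_projections => /=.
  by rewrite linearN opprK vu subr0.
by rewrite linear0 addr0 opprD addrA subrr sub0r linearN.
Qed.

End KernelComplex.

(** * Projective covers of complexes *)

Section Covers.
Variable R : pzRingType.

Lemma fg_cover (V : fgmod R) : exists (Q : fgmod R) (c : {linear Q -> V}),
  [/\ projective Q, forall y, exists x, c x = y &
      (forall y : V, y = 0) -> forall x : Q, x = 0].
Proof.
(* A zero module gets the zero cover, which keeps families of covers bounded. *)
have [V0|V0] := pselect (forall y : V, y = 0).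
  exists (fg0 R), \0; split=> [|y|_ x]; first exact: projective_rV.
    by exists 0; rewrite [RHS]V0.
  by apply/rowP => -[].
have [n [e e_gen]] := fgmodP V.
exists (FgMod (fg_rV R n)), (linear_map (lincomb_linear e)).
split=> [|y|/V0//]; first exact: projective_rV.
have [a ->] := e_gen y; exists (\row_i a i).
by apply: eq_bigr => i _; rewrite mxE.
Qed.

Variable M : cpx R.

(* Q (i + 1) covers M i, so that the cone of the identity of Q, with zero
   differential on Q, is a contractible complex mapping onto M: its term
   Q (i + 1) * Q i is mapped to M i by cov_map i and cov_diff i. *)
Record proj_cover := ProjCover {
  cov_term : int -> fgmod R;
  cov_bounded : bounded_family cov_term;
  cov_map : forall i, {linear cov_term (i + 1) -> M i};
  cov_diff : forall i, {linear cov_term i -> M i};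
  cov_diff_succ : forall i x,
    cov_diff (i + 1) x = diff M i (i + 1) (cov_map i x);
  cov_projective : forall i, projective (cov_term i);
  cov_surj : forall i y, exists x, cov_map i x = y }.

Lemma cover_exists : inhabited proj_cover.
Proof.
have Q_ex j : exists Q : {Q : fgmod R & forall i, {linear Q -> M i}},
    [/\ projective (projT1 Q),
        forall i, j = i + 1 -> forall y, exists x, projT2 Q i x = y &
        (forall y : M (j - 1), y = 0) -> forall x : projT1 Q, x = 0].
  have [Q [c [projQ c_surj Q0]]] := fg_cover (M (j - 1)).
  (* The cover is extended by zero maps to all target degrees, so that it can later be used at any
     [i] with [j = i + 1] without a cast. *)
  have [c' c'E] : exists c' : forall i, {linear Q -> M i}, c' (j - 1) = c.
    exists (fun i => if j - 1 =P i is ReflectT e then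
      ecast k {linear Q -> M k} e c else \0).
    by case: eqP => // e; rewrite eq_axiomK.
  exists (existT _ Q c'); split=> // i ji.
  have -> : i = j - 1 by rewrite ji addrK.
  by rewrite /= c'E.
pose Q j := projT1 (sval (cid (Q_ex j))).
pose c j i : {linear Q j -> M i} := projT2 (sval (cid (Q_ex j))) i.
have projQ j : projective (Q j) by have [] := svalP (cid (Q_ex j)).
have c_surj i y : exists x, c (i + 1) i x = y.
  by have [_ + _] := svalP (cid (Q_ex (i + 1))); apply.
have Q_bounded : bounded_family Q.
  (* The bound grows by one because [Q j] covers [M (j - 1)]. *)
  have [N MN] := cpx_bounded M; exists N.+1 => j Nj.
  have [_ _] := svalP (cid (Q_ex j)); apply; apply: MN.
  by move: Nj; lia.
pose Qdiff j : {linear Q j -> M j} := diff M (j - 1) j \o c j (j - 1).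
have QdiffE i x : Qdiff (i + 1) x = diff M i (i + 1) (c (i + 1) i x).
  rewrite /Qdiff /=; have : i + 1 - 1 = i by rewrite addrK.
  by move: (i + 1 - 1) => k ->.
by constructor; apply: (ProjCover Q_bounded QdiffE projQ c_surj).
Qed.

End Covers.

Section CoverMap.
Variables (R : pzRingType) (M : cpx R) (Q : proj_cover M).
Variables (F : int -> fgmod R) (F_bounded : bounded_family F).
Variable Fmap : forall i, {linear F i -> M i}.
Hypothesis Fmap_cocycle : forall i x, cocycle (Fmap i x).

Lemma cov_diff_coboundary i x : coboundary (cov_diff Q i x).
Proof.
move: x; rewrite -(subrK 1 i) => x.
by rewrite cov_diff_succ; exists (i - 1), (cov_map Q (i - 1) x).
Qed.

Definition contractible_cpx : cpx R :=
  cone (id_cmap (zero_diff_cpx (cov_bounded Q))).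

Definition cover_cpx : cpx R :=
  cpx_sum (zero_diff_cpx F_bounded) contractible_cpx.

Lemma cover_cpx_diff i (x : cover_cpx i) :
  diff cover_cpx i (i + 1) x = (0, (0, x.2.1)).
Proof.
apply: injective_projections => //=.
rewrite -[LHS]/(diff contractible_cpx i (i + 1) x.2) cone_diff_succ /=.
by rewrite oppr0 addr0.
Qed.

Lemma cover_cpx_cocycle i (x : cover_cpx i) : cocycle x <-> x.2.1 = 0.
Proof.
split=> [cx|x0]; last by apply: cocycle_succ; rewrite cover_cpx_diff x0.
by have := cx (i + 1); rewrite cover_cpx_diff => -[].
Qed.

(** With [cover_cpx_cocycle], this says that the cohomology is [F], embedded as the first
    component. *)
Lemma cover_cpx_coboundary i (x : cover_cpx i) :
  coboundary x <-> x.1 = 0 /\ x.2.1 = 0.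
Proof.
move: x; rewrite -(subrK 1 i); move: (i - 1) => {}i x; split.
  by case/coboundary_succ=> y <-; rewrite cover_cpx_diff.
case: x => f [q q'] /= [-> ->]; apply/coboundary_succ.
by exists (0, (q', 0)); rewrite cover_cpx_diff.
Qed.

Definition cover_map_at i (x : cover_cpx i) : M i :=
  Fmap i x.1 + (cov_map Q i x.2.1 + cov_diff Q i x.2.2).

Lemma cover_map_linear i : linear (@cover_map_at i).
Proof.
move=> a x y; rewrite /cover_map_at !linearP !scalerDr /=.
by rewrite [RHS]addrACA; congr (_ + _); rewrite addrACA.
Qed.

Lemma cover_map_diff i j x : diff M i j (linear_map (@cover_map_linear i) x) =
  linear_map (@cover_map_linear j) (diff cover_cpx i j x).
Proof.
have [->|ji] := eqVneq j (i + 1); last by rewrite !diff_shape // linear0.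
rewrite cover_cpx_diff /= /cover_map_at /= !linear0 !add0r cov_diff_succ.
rewrite !linearD Fmap_cocycle add0r.
by rewrite (coboundary_cocycle (cov_diff_coboundary _)) addr0.
Qed.

Definition cover_map : cmap cover_cpx M := CMap cover_map_diff.

Lemma cover_map_surj i y : exists x, cover_map i x = y.
Proof.
have [q <-] := cov_surj Q y; exists (0, (q, 0)).
by rewrite /= /cover_map_at /= !linear0 addr0 add0r.
Qed.

Lemma cover_cpx_acyclic :
  (forall i (f : F i), f = 0) ->
  forall i (x : cover_cpx i), cocycle x -> coboundary x.
Proof.
by move=> F0 i x /cover_cpx_cocycle ?; apply/cover_cpx_coboundary;
  rewrite (F0 i x.1).
Qed.

Lemma cover_cpx_iso : db_iso (zero_diff_cpx F_bounded) cover_cpx.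
Proof.
have in_lin i : linear (fun x : F i => (x, 0) : cover_cpx i).
  move=> a x y; apply: injective_projections => //=.
  by rewrite scaler0 addr0.
have in_diff i j (x : zero_diff_cpx F_bounded i) :
    diff cover_cpx i j (linear_map (in_lin i) x) =
    linear_map (in_lin j) (diff (zero_diff_cpx F_bounded) i j x).
  have [->|ji] := eqVneq j (i + 1); first by rewrite cover_cpx_diff.
  by rewrite !diff_shape // linear0.
apply: (@quasi_iso_db_iso _ _ _ (CMap in_diff)) => i; split=> [z _|w cw].
  by case/cover_cpx_coboundary=> /= -> _; apply: coboundary0.
exists w.1 => //; apply/cover_cpx_coboundary; rewrite /= subrr subr0.
by split=> //; apply/cover_cpx_cocycle.
Qed.

Lemma cover_cpx_projective i : projective (F i) -> projective (cover_cpx i).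
Proof.
by move=> projF; do 2![apply: projective_prod => //]; apply: cov_projective.
Qed.

End CoverMap.

(** * Complexes whose cycles have bounded Ext *)

Section Dimension.
Variable R : pzRingType.
Hypothesis R_noeth : left_noetherian R.
Variable T : fgmod R.
Implicit Types A B M : cpx R.

(* W ranges over all modules isomorphic to Z^i(A) or to B^i(A), which makes the
   condition visibly stable under shifts and under isomorphisms of modules. *)
Definition cycles_Ext_le k A : Prop :=
  forall i (W : lmodType R) (a : {linear W -> A i}), injective a ->
    (forall x, (exists w, a w = x) <-> cocycle x) \/
    (forall x, (exists w, a w = x) <-> coboundary x) ->
  forall j, (k < j)%N -> Ext_eq0 j W T.

Lemma cycles_Ext_le_shift k A n :
  cycles_Ext_le k A -> cycles_Ext_le k (shift A n).
Proof.
move=> Ak i W a a_inj aP; apply: (Ak (i + n) W a) => //.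
case: aP => aP; [left|right] => x; apply: iff_trans (aP x) _.
  exact: shift_cocycle.
exact: shift_coboundary.
Qed.

Definition cocycles A i : submodule (A i).
Proof.
refine (@Submodule R (A i) (@cocycle R A i) _ _ _).
- by move=> k; rewrite linear0.
- by move=> x y cx cy k; rewrite linearD cx cy addr0.
- by move=> a x cx k; rewrite linearZ cx /= scaler0.
Defined.

(** Indexed by the source degree, which makes it the image of a single differential. *)
Definition coboundaries_succ A i : submodule (A (i + 1)) :=
  lin_image (diff A i (i + 1)).

Definition cocycles_incl A i : {linear fg_sub R_noeth (cocycles A i) -> A i} :=
  submodule_incl (cocycles A i).

Lemma cocycles_inclP A i x :
  (exists w, cocycles_incl A i w = x) <-> cocycle x.
Proof. exact: (submodule_inclP (cocycles A i)). Qed.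

Definition coboundaries_incl A i :
    {linear fg_sub R_noeth (coboundaries_succ A i) -> A (i + 1)} :=
  submodule_incl (coboundaries_succ A i).

Lemma coboundaries_inclP A i x :
  (exists w, coboundaries_incl A i w = x) <->
  exists y, diff A i (i + 1) y = x.
Proof. exact: (submodule_inclP (coboundaries_succ A i)). Qed.

(** The cocycles of the kernel in degree [i] are the kernel of a surjection from [F i * Q i] onto
    the cocycles of [M]; its coboundaries in degree [i + 1] are the kernel of a surjection from
    [Q (i + 1)] onto the coboundaries of [M]. [Ext_syzygy] applies to both. *)
Lemma ker_cover_Ext k M (Q : proj_cover M) (F : int -> fgmod R)
    (F_bounded : bounded_family F) (Fmap : forall i, {linear F i -> M i})
    (Fmap_cocycle : forall i x, cocycle (Fmap i x)) :
  (forall i, projective (F i)) ->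
  (forall i x, cocycle x -> exists y, Fmap i y = x) ->
  cycles_Ext_le k.+1 M ->
  cycles_Ext_le k (ker_cpx R_noeth (cover_map Q F_bounded Fmap_cocycle)).
Proof.
move=> projF Fmap_surj Mk i W a a_inj aP j kj.
set p := cover_map Q F_bounded Fmap_cocycle in a a_inj aP *.
pose b w : cover_cpx Q F_bounded i := ker_incl_at R_noeth p i (a w).
have b_ker w : cover_map_at Fmap (b w) = 0
  by exact: (@ker_incl_ker _ R_noeth _ _ p i (a w)).
have b_cocycle w : cocycle (a w) <-> cocycle (b w).
  exact: (@ker_cocycle _ R_noeth _ _ p i (a w)).
have b_inj w : b w = 0 -> w = 0.
  move=> bw; apply: a_inj; apply: (@ker_incl_inj _ R_noeth _ _ p).
  by rewrite !linear0.
case: aP => aP.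
  have bP x : (exists w, b w = x) <-> p i x = 0 /\ cocycle x.
    split=> [[w <-]|[px cx]].
      split; first exact: b_ker.
      by apply/b_cocycle/aP; exists w.
    have [w wE] := (ker_inclP R_noeth p x).2 px.
    have [|v vE] := (aP w).2; last by exists v; rewrite /b vE.
    by apply/(@ker_cocycle _ R_noeth _ _ p i w); rewrite wE.
  (* On cocycles the component in [Q (i + 1)] is zero, so the other two determine the element. *)
  have b_lin : linear (fun w => ((b w).1, (b w).2.2)).
    by move=> c x y; rewrite /b !linearP.
  pose g : {linear (F i * cov_term Q i)%type -> M i} :=
    (Fmap i \o fst) \+ (cov_diff Q i \o snd).
  have [|h hE] := factor_inj (f := g) (i := cocycles_incl M i)
      (@submodule_incl_inj _ _ _).
    move=> u; apply/cocycles_inclP => l; rewrite linearD Fmap_cocycle add0r.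
    exact: (coboundary_cocycle (cov_diff_coboundary _)).
  have b21 w : (b w).2.1 = 0.
    by have [_ /cover_cpx_cocycle] := (bP (b w)).1 (ex_intro _ w erefl).
  apply: (Ext_syzygy (a := linear_map b_lin) (b := h)) => //.
  - exact: projective_prod (projF i) (@cov_projective _ _ Q i).
  - apply: ker0_inj => w [w1 w22]; apply: b_inj.
    by move: w1 w22 (b21 w); case: (b w) => x [y z] /= -> -> ->.
  - move=> y; have [|x xE] := Fmap_surj i (cocycles_incl M i y).
      by apply/cocycles_inclP; exists y.
    exists (x, 0); apply: (@submodule_incl_inj _ _ (cocycles M i)).
    by rewrite [LHS]hE /= linear0 addr0.
  - case=> x y; split=> [hxy|[w [<- <-]]].
      have [|w wE] := (bP (x, (0, y))).2; last by exists w; rewrite /= wE.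
      split; last exact/cover_cpx_cocycle.
      transitivity (g (x, y)); last by rewrite -hE hxy linear0.
      by rewrite /= /cover_map_at /= linear0 add0r.
    apply: (@submodule_incl_inj _ _ (cocycles M i)).
    rewrite [LHS]hE [RHS]linear0 -(b_ker w) /cover_map_at b21.
    by rewrite linear0 add0r.
  - by case: (j) kj.
  - apply: (Mk i _ (cocycles_incl M i)) => //; first exact: submodule_incl_inj.
    by left=> x; apply: cocycles_inclP.
have Kb (x : ker_cpx R_noeth p i) : coboundary x ->
  coboundary (ker_incl_at R_noeth p i x).
  by case=> l [y <-]; exists l, (ker_incl_at R_noeth p l y); rewrite ker_diffE.
(* Coboundary case: all that depends on [i] is generalized, so that the degree can become a
   successor. *)
move: a a_inj aP @b b_ker {b_cocycle} b_inj Kb.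
rewrite -(subrK 1 i); move: (i - 1) => {}i a a_inj aP b b_ker b_inj Kb.
have b0 w : (b w).1 = 0 /\ (b w).2.1 = 0.
  by apply/cover_cpx_coboundary/Kb/aP; exists w.
have b_lin : linear (fun w => (b w).2.2) by move=> c x y; rewrite /b !linearP.
have [|h hE] := factor_inj (f := cov_diff Q (i + 1)) (i :=
  coboundaries_incl M i)
    (@submodule_incl_inj _ _ _).
  by move=> u; apply/coboundaries_inclP; rewrite cov_diff_succ;
    exists (cov_map Q i u).
apply: (Ext_syzygy (a := linear_map b_lin) (b := h)) => //.
- exact: cov_projective.
- apply: ker0_inj => w /= w22; apply: b_inj; move: w22 (b0 w).
  by case: (b w) => x [y z] /= -> [-> ->].
- move=> y; have [|x xE] := (coboundaries_inclP (coboundaries_incl M i y)).1.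
    by exists y.
  have [q qE] := cov_surj Q x; exists q.
  apply: (@submodule_incl_inj _ _ (coboundaries_succ M i)).
  by rewrite [LHS]hE cov_diff_succ qE xE.
- move=> x; split=> [hx|[w <-]]; last first.
    apply: (@submodule_incl_inj _ _ (coboundaries_succ M i)).
    rewrite [LHS]hE [RHS]linear0 -(b_ker w) /cover_map_at.
    by have [-> ->] := b0 w; rewrite !linear0 !add0r.
  have dx : diff M i (i + 1) (cov_map Q i x) = 0.
    by rewrite -cov_diff_succ -hE hx linear0.
  (* Surjectivity of [Fmap] on cocycles corrects [(0, (x, 0))] to an element of the kernel with the
     same differential. *)
  have [y yE] := Fmap_surj i _ (cocycle_succ dx).
  have [|v vE] := (ker_inclP R_noeth p (- y, (x, 0)) ).2.
    by rewrite /= /cover_map_at /= linear0 addr0 linearN yE addNr.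
  have [|w wE] := (aP (diff (ker_cpx R_noeth p) i (i + 1) v)).2.
    by apply/coboundary_succ; exists v.
  by exists w; rewrite /= /b wE ker_diffE vE cover_cpx_diff.
- by case: (j) kj.
- apply: (Mk (i + 1) _ (coboundaries_incl M i)) => //;
  first exact: submodule_incl_inj.
  right=> x; apply: iff_trans (coboundaries_inclP x) _.
  by apply: iff_sym; apply: coboundary_succ.
Qed.

Lemma star_base M :
  cycles_Ext_le 0 M -> star_pow (gen1 (in_degree0 (XT T))) 1 M.
Proof.
move=> M0.
pose Z i := fg_sub R_noeth (cocycles M i).
(* The coboundaries of degree [i + 1] sit in degree [i], so the shift in B[1] is built in. *)
pose B i := fg_sub R_noeth (coboundaries_succ M i).
have Z_bounded : bounded_family Z.
  have [N MN] := cpx_bounded M; exists N => i Ni z.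
  by apply: (@submodule_incl_inj _ _ (cocycles M i)); rewrite linear0;
    apply: MN.
have B_bounded : bounded_family B.
  have [N MN] := cpx_bounded M; exists N.+1 => i Ni z.
  apply: (@submodule_incl_inj _ _ (coboundaries_succ M i)).
  by rewrite linear0; apply: MN; lia.
have Z_cocycle i z : cocycle (cocycles_incl M i z) by apply/cocycles_inclP;
  exists z.
have Z_diff i j (z : zero_diff_cpx Z_bounded i) :
    diff M i j (cocycles_incl M i z) =
    cocycles_incl M j (diff (zero_diff_cpx Z_bounded) i j z).
  by rewrite [RHS]linear0 Z_cocycle.
pose f : cmap (zero_diff_cpx Z_bounded) M := CMap Z_diff.
(* The comparison of the cone of Z -> M with B[1] sends [(z, m)] to the differential of [m]. *)
have q_ex i : exists q : {linear cone f i -> B i},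
    forall x, coboundaries_incl M i (q x) = diff M i (i + 1) x.2.
  apply: (factor_inj (f := diff M i (i + 1) \o snd)) => [|x].
    exact: submodule_incl_inj.
  by apply/coboundaries_inclP; exists x.2.
pose q i := sval (cid (q_ex i)).
have qE i x : coboundaries_incl M i (q i x) = diff M i (i + 1) x.2.
  exact: (svalP (cid (q_ex i))).
have q_diff i j (x : cone f i) : diff (zero_diff_cpx B_bounded) i j (q i x) =
    q j (diff (cone f) i j x).
  have [->|ji] := eqVneq j (i + 1); last by rewrite !diff_shape // linear0.
  apply: (@submodule_incl_inj _ _ (coboundaries_succ M (i + 1))).
  rewrite [LHS]linear0 [RHS]qE cone_diff_succ [RHS]linearD diff_diff addr0.
  by rewrite [RHS]Z_cocycle.
apply: (star_cone (f := f)).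
- apply: gen1_zero_diff => i j j0.
  apply: (M0 i _ (cocycles_incl M i)) => //; first exact: submodule_incl_inj.
  by left=> x; apply: cocycles_inclP.
- apply: (@gen1_zero_diff _ _ B B_bounded) => i j j0.
  apply: (M0 (i + 1) _ (coboundaries_incl M i)) => //.
    exact: submodule_incl_inj.
  right=> x; apply: iff_trans (coboundaries_inclP x) _.
  by apply: iff_sym; apply: coboundary_succ.
apply: db_iso_sym; apply: (@quasi_iso_db_iso _ _ _ (CMap q_diff)) => i.
split=> [x cx [j [b /= bx]]|w _].
  have dx : diff M i (i + 1) x.2 = 0 by rewrite -qE -bx linear0.
  have x1 : x.1 = 0.
    have := cx (i + 1); rewrite cone_diff_succ => -[_]; rewrite dx addr0.
    rewrite -(linear0 (cocycles_incl M (i + 1))).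
    exact: (@submodule_incl_inj _ _ (cocycles M (i + 1))).
  case: x x1 dx {cx bx} => z m /= -> /cocycle_succ.
  rewrite -(subrK 1 i) in z m *; move: (i - 1) m => k m cm.
  have [w wm] := (cocycles_inclP m).2 cm.
  apply/coboundary_succ; exists (w, 0); rewrite cone_diff_succ /=.
  by apply: injective_projections; rewrite /= ?oppr0 // linear0 addr0.
have [|m mw] := (coboundaries_inclP (coboundaries_incl M i w)).1;
  first by exists w.
(* This [z] makes [(z, m)] a cocycle of the cone lying over [w]. *)
have [|z zE] := (cocycles_inclP (- diff M i (i + 1) m)).2.
  by move=> k; rewrite linearN diff_diff oppr0.
exists (z, m).
  apply: cocycle_succ; rewrite cone_diff_succ;
    apply: injective_projections => /=.
    by rewrite oppr0.
  exact: etrans (congr1 (+%R^~ _) zE) (addNr _).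
have -> : w = q i (z, m).
  by apply: (@submodule_incl_inj _ _ (coboundaries_succ M i));
    rewrite [RHS]qE /= mw.
by rewrite subrr; apply: coboundary0.
Qed.

(** The exponent [k.+1] stands for [k + 2] factors: two from the base case and one from each
    lowering of the bound. *)
Lemma star_pow_cycles_Ext k M :
  cycles_Ext_le k M -> star_pow (gen1 (in_degree0 (XT T))) k.+1 M.
Proof.
elim: k M => [|k IHk] M Mk; first exact: star_base.
(* A projective cover of the cocycles in each degree, zero where [M i] is zero. *)
have F_ex i : exists F : {F : fgmod R & {linear F -> M i}},
    [/\ projective (projT1 F),
        forall x, cocycle x <-> exists y, projT2 F y = x &
        (forall x : M i, x = 0) -> forall x : projT1 F, x = 0].
  have [F [c [projF c_surj F0]]] := fg_cover (fg_sub R_noeth (cocycles M i)).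
  exists (existT _ F (cocycles_incl M i \o c : {linear F -> M i}));
    split=> // [x|M0].
    split=> [/cocycles_inclP[z <-]|[y <-]]; last by apply/cocycles_inclP;
      exists (c y).
    by have [y <-] := c_surj z; exists y.
  apply: F0 => z; apply: (@submodule_incl_inj _ _ (cocycles M i)).
  by rewrite linear0; apply: M0.
pose F i := projT1 (sval (cid (F_ex i))).
pose Fmap i : {linear F i -> M i} := projT2 (sval (cid (F_ex i))).
have projF i : projective (F i) by have [] := svalP (cid (F_ex i)).
have FmapP i x : cocycle x <-> exists y, Fmap i y = x.
  by have [_ + _] := svalP (cid (F_ex i)); apply.
have F_bounded : bounded_family F.
  have [N MN] := cpx_bounded M; exists N => i Ni.
  by have [_ _] := svalP (cid (F_ex i)); apply; apply: MN.
have Fmap_cocycle i x : cocycle (Fmap i x) by apply/FmapP; exists x.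
have [Q] := cover_exists M.
pose p := cover_map Q F_bounded Fmap_cocycle.
apply: (star_cone (f := p) (Y := shift (ker_cpx R_noeth p) 1)).
- apply: gen1_iso (cover_cpx_iso _ _) _; apply: gen1_zero_diff => i j j0.
  exact: Ext_projective.
- by apply/IHk/cycles_Ext_le_shift/ker_cover_Ext => // i x /FmapP.
- apply: quasi_iso_db_iso; apply: ker_cone_quasi_iso.
  exact: cover_map_surj.
Qed.

Lemma cycles_Ext_replacement d M : injdim_le T d ->
  exists2 N, db_iso N M & cycles_Ext_le (maxn 1 d).-1 N.
Proof.
move=> Td; have [Q] := cover_exists M.
(* With [F] zero the cover is contractible, so [M], the cone of [p] and the shifted kernel all
   agree. *)
pose F (i : int) := fg0 R.
have F0 i (x : F i) : x = 0 by apply/rowP => -[].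
have F_bounded : bounded_family F by exists 0%N => i _.
pose Fmap i : {linear F i -> M i} := \0.
have Fmap_cocycle i x : cocycle (Fmap i x) by move=> k; rewrite linear0.
pose p := cover_map Q F_bounded Fmap_cocycle.
exists (shift (ker_cpx R_noeth p) 1).
  apply: (db_iso_trans (B := cone p)).
    apply: quasi_iso_db_iso; apply: ker_cone_quasi_iso.
    exact: cover_map_surj.
  apply: db_iso_sym; apply: quasi_iso_db_iso; apply: cone_in_quasi_iso.
  exact: cover_cpx_acyclic.
(* Cocycles and coboundaries are treated alike: each embeds in a projective term of the cover. *)
apply: cycles_Ext_le_shift => i W a a_inj _ j dj.
apply: (Ext_sub_projective (a := ker_incl_at R_noeth p i \o a) Td).
- exact/cover_cpx_projective/projective_rV.
- by apply: inj_comp a_inj; apply: ker_incl_inj.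
- by move: dj; rewrite prednK // leq_max.
Qed.

Lemma genS_XT d M :
  injdim_le T d -> genS (in_degree0 (XT T)) (maxn 1 d) M.
Proof.
move=> Td; have [N NM N_Ext] := cycles_Ext_replacement M Td.
apply: add_iso NM _; apply: add_in.
by have := star_pow_cycles_Ext N_Ext; rewrite prednK // leq_max.
Qed.

End Dimension.

(** * Infima in the extended integers and the final bound *)

Lemma einfn_le (P : nat -> Prop) n : P n -> (einfn P <= (Posz n)%:E)%E.
Proof.
move=> Pn; rewrite /einfn; case: pselect => [exP|[]]; last by exists n;
  apply/asboolP.
by case: ex_minnP => m _ /(_ n); rewrite lee_fin lez_nat; apply; apply/asboolP.
Qed.

Lemma einfn_lt_pinfty (P : nat -> Prop) :
  (einfn P < +oo)%E -> exists2 n, P n & einfn P = (Posz n)%:E.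
Proof.
rewrite /einfn; case: pselect => // exP _.
by case: ex_minnP => n /asboolP Pn _; exists n.
Qed.

Local Open Scope ereal_scope.

Theorem corollary1p2 (L : pzRingType) (T : fgmod L^c) :
  noetherian L -> cotilting T ->
  tri_dim (in_degree0 (XT T)) <= maxe 1%:E (inj_dim T).
Proof.
(* Finite injective dimension provides a natural number [d] attaining it; the modules live over
   [L^c], whose left ideals are the right ideals of [L]. *)
move=> [_ Lc_noeth] [/einfn_lt_pinfty[d Td dE] _ _].
have -> : maxe 1%:E (inj_dim T) = (Posz (maxn 1 d))%:E.
  rewrite /inj_dim dE -EFin_max; congr (_%:E).
  by rewrite /Order.max /maxn ltz_nat; case: ifP.
by rewrite /tri_dim; apply: einfn_le => M; apply: genS_XT.
Qed.
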